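(* Let $0<\mu<\overline{v}$ and consider the setting with $n=2$ bidders. Let $\underline{v}$ be the unique solution in $(0,\overline{v}]$ of $$\underline{v}\left(1+\log\overline{v}-\log\underline{v}\right)=\mu .$$ Define $$F^*(v)=\begin{cases}0 & v\in[0,\underline{v}],\\ 1-\underline{v}/v & v\in[\underline{v},\overline{v}),\\ 1 & v\ge\overline{v},\end{cases}$$ $$Q^*(r)=\begin{cases}\left(1-\frac{\underline{v}}{\overline{v}}\right)\cdot\frac{1}{\log\overline{v}-\log\underline{v}} & r\in[0,\underline{v}],\\[4pt] \left(1-\frac{\underline{v}}{\overline{v}}\right)\cdot\frac{r}{r-\underline{v}}\cdot\frac{\log r-\log\underline{v}}{\log\overline{v}-\log\underline{v}} & r\in(\underline{v},\overline{v}].\end{cases}$$ Then $Q^*\in\mathcal{Q}$, $F^*\in\mathcal{F}$, and $(Q^*,F^* )$ is an equilibrium of the reduced zero-sum game, i.e. $$\mathrm{Rev}_{F^*}(Q)\le \mathrm{Rev}_{F^*}(Q^* )\le \mathrm{Rev}_{F}(Q^* )\qquad\text{for all } Q\in\mathcal{Q},\ F\in\mathcal{F};$$ in particular $$Q^*\in\operatorname*{argmax}_{Q\in\mathcal{Q}}\min_{F\in\mathcal{F}}\mathrm{Rev}_F(Q),\qquad F^*\in\operatorname*{argmin}_{F\in\mathcal{F}}\max_{Q\in\mathcal{Q}}\mathrm{Rev}_F(Q).$$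
   Context: A seller offers one item to $n$ bidders whose values $v_1,\dots,v_n$ are i.i.d. from a distribution $F$. Distributions are identified with their CDFs (so they are $0$ on $(-\infty,0)$ and $1$ on $[\overline{v},\infty)$ for distributions supported in $[0,\overline{v}]$); $\log$ is the natural logarithm. $\mathcal{F}=\mathcal{F}(\mu,\overline{v})$ is the set of all probability distributions with expectation $\mu$ and support contained in $[0,\overline{v}]$. $\mathcal{Q}$ is the set of all probability distributions (of reserve prices) with support contained in $[0,\overline{v}]$. In the second-price auction with reserve $r$, bidders bid their values; the item is sold to a highest bidder if and only if the highest value is strictly greater than $r$, and the winner then pays the maximum of $r$ and the second-highest value. Thus, with $v^{(1)}\ge v^{(2)}$ the two highest of the values $v_1,\dots,v_n$ drawn i.i.d. from $F$, $$\mathrm{Rev}_F(r)=\mathbb{E}\left[\max\{r,v^{(2)}\}\cdot \mathbf{1}_{v^{(1)}>r}\right],\qquad \mathrm{Rev}_F(Q)=\mathbb{E}_{r\sim Q}\left[\mathrm{Rev}_F(r)\right].$$ In the reduced zero-sum game the seller chooses $Q\in\mathcal{Q}$, the adversary chooses $F\in\mathcal{F}$, and the payoff $\mathrm{Rev}_F(Q)$ is maximized by the seller and minimized by the adversary. *)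

(* Defs.v *)
From HB Require Import structures.
From mathcomp Require Import all_boot all_order all_algebra.
From mathcomp Require Import all_classical all_reals all_analysis.

Set Implicit Arguments.
Unset Strict Implicit.
Unset Printing Implicit Defensive.

Import Order.TTheory GRing.Theory Num.Theory.
Import numFieldNormedType.Exports.

Local Open Scope classical_set_scope.
Local Open Scope ring_scope.

(* A distribution on the line is a Borel probability measure. Its values on
   Borel sets, hence every integral against it, are determined by its CDF. *)
Notation distr R := (probability (measurableTypeR R) R).

Definition idRV (R : realType) : measurableTypeR R -> R := idfun.

HB.instance Definition _ (R : realType) :=
  @isMeasurableFun.Build _ _ _ _ (@idRV R) (@measurable_id _ _ setT).

Definition has_cdf (R : realType) (P : distr R) (G : R -> R) : Prop :=
  forall x : R, cdf (@idRV R : {RV P >-> R}) x = (G x)%:E.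

Definition supported_in (R : realType) (P : distr R) (vbar : R) : Prop :=
  P `[0, vbar]%classic = 1%E.

Definition value_distrs (R : realType) (mu vbar : R) : set (distr R) :=
  [set F | supported_in F vbar /\ ('E_F[@idRV R] = mu%:E)%E].

Definition reserve_distrs (R : realType) (vbar : R) : set (distr R) :=
  [set Q | supported_in Q vbar].

(* With two bidders the highest and second-highest values are the maximum and
   the minimum of the pair [v]. *)
Definition payment (R : realType) (r : R) (v : R * R) : R :=
  Num.max r (Num.min v.1 v.2) * (r < Num.max v.1 v.2)%R%:R.

Definition reserve_revenue (R : realType) (F : distr R) (r : R) : \bar R :=
  ('E_(F \x F)[payment r])%E.

Definition revenue (R : realType) (F Q : distr R) : \bar R :=
  (\int[Q]_r reserve_revenue F r)%E.

Definition argmax (T : Type) (R : realType) (A : set T) (f : T -> \bar R) :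
    set T :=
  [set x | A x /\ forall y, A y -> (f y <= f x)%E].

Definition argmin (T : Type) (R : realType) (A : set T) (f : T -> \bar R) :
    set T :=
  [set x | A x /\ forall y, A y -> (f x <= f y)%E].

(* The inner optimum is an infimum (resp. a supremum): against a fixed [F] the
   seller's supremum need not be attained, because a sale requires a value
   strictly above the reserve. *)
Definition worst_case_revenue (R : realType) (mu vbar : R) (Q : distr R) : \bar R :=
  ereal_inf [set revenue F Q | F in value_distrs mu vbar].

Definition best_response_revenue (R : realType) (vbar : R) (F : distr R) : \bar R :=
  ereal_sup [set revenue F Q | Q in reserve_distrs vbar].

Definition is_vlow (R : realType) (mu vbar vlow : R) : Prop :=
  0 < vlow <= vbar /\ vlow * (1 + ln vbar - ln vlow) = mu.

Definition Fstar (R : realType) (vbar vlow v : R) : R :=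
  if v < vbar then (if v <= vlow then 0 else 1 - vlow / v) else 1.

Definition Qstar (R : realType) (vbar vlow r : R) : R :=
  if r < 0 then 0
  else if r <= vlow then (1 - vlow / vbar) * (1 / (ln vbar - ln vlow))
  else if r <= vbar then
    (1 - vlow / vbar) * (r / (r - vlow))
      * ((ln r - ln vlow) / (ln vbar - ln vlow))
  else 1.

(* Main.v *)
(** With [S t = P (v > t)], the revenue of a reserve [r >= 0] is
    [r * (2 * S r - S r ^+ 2) + \int_(t >= r) S t ^+ 2]. Against [Fstar], where
    [S t = vlow / t] on [vlow, vbar[, this is a constant for [0 <= r < vbar] and
    0 afterwards, so no reserve beats [Qstar], which has no atom at [vbar].

    [Qstar] has an atom [c] at 0 and a density [q] on ]vlow, vbar[. By Tonelli the
    revenue of [Qstar] against [F] is the integral over [t >= 0] of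
    [t * q t * (2 * S t - S t ^+ 2) + Qstar t * S t ^+ 2], which is for each [t] a
    convex quadratic in [S t]. [Qstar] is chosen so that the tangent of this
    quadratic at the survival function of [Fstar] has the same slope [2 * c] for
    all [t]. As [\int_(t >= 0) S t] is the mean of [F], which is fixed, the tangent
    inequality shows that [Fstar] minimizes the revenue. *)
Require Import Defs.
From HB Require Import structures.
From mathcomp Require Import all_boot all_order all_algebra.
From mathcomp Require Import all_classical all_reals all_analysis.
From mathcomp Require Import measurable_realfun ring lra.
Import Order.TTheory GRing.Theory Num.Theory.
Import numFieldNormedType.Exports.
Local Open Scope classical_set_scope.
Local Open Scope ring_scope.
Set Implicit Arguments.
Unset Strict Implicit.
Unset Printing Implicit Defensive.

(** * Distributions with an atom and a density *)

Section density_measure.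
Context d (T : measurableType d) (R : realType) (m : {measure set T -> \bar R}).
Variable g : T -> R.

(** The proofs [g0] and [mg] are arguments so that the measure structure declared below attaches to
    the term [density g0 mg]. *)
Definition density (g0 : forall x, 0 <= g x)
    (mg : measurable_fun [set: T] g) (A : set T) : \bar R :=
  (\int[m]_(x in A) (g x)%:E)%E.

Hypotheses (g0 : forall x, 0 <= g x) (mg : measurable_fun [set: T] g).

Local Notation P := (density g0 mg).

Let P0 : P set0 = 0%E.
Proof. by rewrite /density integral_set0. Qed.

Let P_ge0 A : (0 <= P A)%E.
Proof. by apply: integral_ge0 => x _; rewrite lee_fin. Qed.

Let mgE : measurable_fun [set: T] (fun x => (g x)%:E).
Proof. exact/measurable_EFinP. Qed.

Let P_sigma_additive : semi_sigma_additive P.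
Proof.
move=> /= F mF tF mUF; apply: cvg_toP.
  apply: ereal_nondecreasing_is_cvgn => p n pn.
  exact: lee_sum_nneg_natr.
rewrite /density ge0_integral_bigcup//=.
- exact: measurable_funTS.
- by move=> x _; rewrite lee_fin.
Qed.

HB.instance Definition _ := isMeasure.Build _ _ _ P P0 P_ge0 P_sigma_additive.

Import HBNNSimple.

(** For a simple function the identity reduces to its level sets; monotone convergence on both sides
    then gives it for every nonnegative measurable [f]. *)
Lemma ge0_integral_density (f : T -> \bar R) :
  measurable_fun [set: T] f -> (forall x, 0 <= f x)%E ->
  (\int[P]_x f x = \int[m]_x (f x * (g x)%:E))%E.
Proof.
move=> mf f0; pose f_ := nnsfun_approx measurableT mf.
have simple (h : {nnsfun T >-> R}) :
    (\int[P]_x (h x)%:E = \int[m]_x ((h x)%:E * (g x)%:E))%E.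
  under [LHS]eq_integral do rewrite fimfunE -fsumEFin//.
  rewrite [LHS]ge0_integral_fsum//; last 2 first.
    - by move=> r; exact/measurable_EFinP/measurableT_comp.
    - by move=> n x _; rewrite EFinM nnfun_muleindic_ge0.
  under [RHS]eq_integral.
    move=> x _; rewrite fimfunE -fsumEFin// ge0_mule_fsuml; last first.
      by move=> r; rewrite EFinM nnfun_muleindic_ge0.
    over.
  rewrite [RHS]ge0_integral_fsum//; last 2 first.
    - move=> r; apply: emeasurable_funM => //.
      exact/measurable_EFinP/measurableT_comp.
    - move=> n x _; rewrite mule_ge0//; last by rewrite lee_fin.
      by rewrite EFinM nnfun_muleindic_ge0.
  apply: eq_fsbigr => r _.
  rewrite integralZl_indic_nnsfun//= integral_indic// setIT /= /density.
  (* The factor [r] can be moved under the integral only if it is nonnegative. For [r < 0] the level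
     set of the nonnegative [h] is empty. *)
  have [r0|r0] := leP 0 r; last first.
    have -> : h @^-1` [set r] = set0.
      apply/seteqP; split => x //= hx; have : 0 <= h x by exact: fun_ge0.
      by rewrite hx leNgt r0.
    rewrite integral_set0 mule0; apply/esym; apply: integral0_eq => x _.
    by rewrite indic0 mulr0 mul0e.
  rewrite integral_mkcond -ge0_integralZl//.
  - apply: eq_integral => x _; rewrite patchE indicE.
    by case: ifPn => _; rewrite ?mulr1 ?mulr0 ?mule0 ?mul0e.
  - apply/(measurable_restrictT _ _).1 => //.
    exact: measurable_funTS.
  - by move=> x _; apply: erestrict_ge0 => y _; rewrite lee_fin.
transitivity (lim (\int[P]_x (f_ n x)%:E @[n --> \oo])%E).
  rewrite -monotone_convergence//=.
  - apply: eq_integral => ? /[!inE] xD; apply/esym/cvg_lim => //=.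
    exact: cvg_nnsfun_approx.
  - by move=> n; exact/measurable_EFinP/measurable_funTS.
  - by move=> n ? _; rewrite lee_fin.
  - by move=> ? _ ? ? mn; rewrite lee_fin; exact/lefP/nd_nnsfun_approx.
rewrite (_ : \int[m]_x _ = lim
    (\int[m]_x ((f_ n x)%:E * (g x)%:E) @[n --> \oo]))%E; last first.
  rewrite -monotone_convergence//=.
  - apply: eq_integral => ? /[!inE] xD; apply/esym/cvg_lim => //.
    by apply: cvgeZr => //; exact: cvg_nnsfun_approx.
  - move=> n; apply: emeasurable_funM => //.
    exact/measurable_EFinP/measurable_funTS.
  - by move=> n ? _; rewrite mule_ge0// lee_fin.
  - move=> x _ ? ? mn; rewrite lee_wpmul2r ?lee_fin//.
    exact/lefP/nd_nnsfun_approx.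
by apply: congr_lim; apply/funext => n /=; exact: simple.
Qed.

End density_measure.

(** The witness is [w] times the Dirac mass at [a] plus the measure with density [g]. It is
    characterized by its integrals, which is the form needed to compute revenues. *)
Lemma exists_atom_density (R : realType) (w a : R) (g : R -> R) :
  0 <= w -> (forall x, 0 <= g x) -> measurable_fun setT g ->
  (\int[@lebesgue_measure R]_x (g x)%:E = (1 - w)%:E)%E ->
  exists P : distr R, forall f : R -> \bar R, measurable_fun setT f ->
    (forall x, 0 <= f x)%E ->
    (\int[P]_x f x = w%:E * f a +
       \int[@lebesgue_measure R]_x (f x * (g x)%:E))%E.
Proof.
move=> w0 g0 mg intg.
pose G : {measure set (measurableTypeR R) -> \bar R} :=
  density (@lebesgue_measure R) g0 mg.
pose P : {measure set (measurableTypeR R) -> \bar R} :=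
  measure_add (mscale (NngNum w0) (\d_ (a : measurableTypeR R))) G.
have P1 : P setT = 1%E.
  transitivity (w%:E * 1 + G setT)%E; last first.
    rewrite (_ : G setT = (1 - w)%:E); last exact: intg.
    by rewrite mule1 -EFinD addrC subrK.
  transitivity (mscale (NngNum w0) (\d_ (a : measurableTypeR R)) setT +
      G setT)%E; first exact: measure_addE.
  by congr (_ * _ + _)%E; exact: diracT.
pose mP := Measure_isProbability.Build _ _ R P P1.
pose Q : distr R := HB.pack (Measure.sort P) (Measure.class P) mP.
exists Q => f mf f0; rewrite /Q/= ge0_integral_measure_add//.
by rewrite ge0_integral_mscale// integral_dirac// diracT mul1e ge0_integral_density.
Qed.

(** * Fundamental theorem of calculus on an open interval, and distributions built from a
    primitive *)

(** The open interval is exhausted by compact ones, where the usual theorem applies; the integrals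
    converge by monotonicity and the primitive by its one-sided limits. Limits replace endpoint
    values because the formulas for [Qstar] above the cutoff divide by zero at the cutoff. *)
Lemma ge0_FTC2_oo (R : realType) (f F : R -> R) (a b A B : R) : a < b ->
  {in `]a, b[, forall x, 0 <= f x} -> {in `]a, b[, continuous f} ->
  {in `]a, b[, forall x : R, is_derive x 1 F (f x)} ->
  F x @[x --> a^'+] --> A -> F x @[x --> b^'-] --> B ->
  (\int[@lebesgue_measure R]_(x in `]a, b[) (f x)%:E = (B - A)%:E)%E.
Proof.
move=> ab f0 cf dF Fa Fb.
(* The shift by 3 gives [2 * e n < b - a] already for [n = 0], so that no compact interval is
   degenerate. *)
pose e (n : nat) : R := (b - a) * n.+3%:R^-1.
have ba0 : 0 < b - a by rewrite subr_gt0.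
have e0 n : 0 < e n by rewrite mulr_gt0// invr_gt0.
have e2 n : e n + e n < b - a.
  have h : n.+3%:R^-1 <= 3^-1 :> R by rewrite lef_pV2 ?posrE// ler_nat.
  by rewrite /e -mulrDr gtr_pMr//; move: (_^-1) h => x; lra.
have e_cvg : e n @[n --> \oo] --> (0 : R).
  rewrite -(mulr0 (b - a)); apply: cvgM; first exact: cvg_cst.
  have := @cvg_harmonic R; rewrite -(cvg_shiftn 2).
  by under eq_fun do rewrite addn2.
have e_dec m n : (m <= n)%N -> e n <= e m.
  move=> mn; rewrite /e ler_pM2l// lef_pV2 ?posrE//.
  by rewrite ler_nat.
have mf : measurable_fun `]a, b[%classic f.
  by apply: open_continuous_measurable_fun => // x; rewrite inE => xab; exact: cf.
pose I n := `[a + e n, b - e n]%classic.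
have I_sub n : I n `<=` `]a, b[%classic.
  move=> x; rewrite /I/= !in_itv/= => /andP[ax xb].
  have en := e0 n; apply/andP; split; lra.
have cupI : \bigcup_n I n = `]a, b[%classic.
  apply/seteqP; split => [x [n _ /I_sub]//|x].
  rewrite /= in_itv/= => /andP[ax xb].
  have : \forall n \near \oo, e n < Num.min (x - a) (b - x).
    have m0 : 0 < Num.min (x - a) (b - x) by rewrite lt_min !subr_gt0 ax xb.
    by move/cvgrPdist_lt : e_cvg => /(_ _ m0); apply: filterS => n; rewrite sub0r normrN gtr0_norm.
  move=> [n _ /(_ n (leqnn n))]; rewrite lt_min => /andP[h1 h2].
  by exists n => //; rewrite /I/= in_itv/=; apply/andP; split; lra.
have intI n : (\int[@lebesgue_measure R]_(x in I n) (f x)%:E =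
    (F (b - e n) - F (a + e n))%:E)%E.
  have en := e0 n; have e2n := e2 n.
  rewrite /I EFinB; apply: continuous_FTC2.
  - by lra.
  - apply: continuous_in_subspaceT => x; rewrite inE => /I_sub; exact: cf.
  - split => [x xI||].
    + have /dF : x \in `]a, b[ by apply: (I_sub n); exact: subset_itv_oo_cc.
      by move=> ?; apply: ex_derive.
    + have /dF h : a + e n \in `]a, b[ by rewrite in_itv/=; lra.
      apply: cvg_at_right_filter; apply: differentiable_continuous.
      by apply/derivable1_diffP; apply: ex_derive.
    + have /dF h : b - e n \in `]a, b[ by rewrite in_itv/=; lra.
      apply: cvg_at_left_filter; apply: differentiable_continuous.
      by apply/derivable1_diffP; apply: ex_derive.
  - move=> x xI; have /dF h : x \in `]a, b[.
      by apply: (I_sub n); exact: subset_itv_oo_cc.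
    by rewrite derive1E derive_val.
have lim1 : (\int[@lebesgue_measure R]_(x in I n) (f x)%:E)%E @[n --> \oo] -->
    (\int[@lebesgue_measure R]_(x in `]a, b[) (f x)%:E)%E.
  rewrite -cupI; apply: ge0_nondecreasing_set_cvg_integral.
  - move=> m n mn; apply/subsetPset => x; rewrite /I/= !in_itv/= => /andP[h1 h2].
    have emn := e_dec _ _ mn; apply/andP; split; lra.
  - by move=> n; exact: measurable_itv.
  - move=> n; apply/measurable_EFinP; exact: measurable_funS mf.
  - by move=> n x /I_sub xab; rewrite lee_fin f0.
have lim2 : (\int[@lebesgue_measure R]_(x in I n) (f x)%:E)%E @[n --> \oo] -->
    (B - A)%:E.
  under eq_fun do rewrite intI.
  apply: cvg_EFin; first exact: nearW.
  apply: cvgB.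
  - have /cvg_at_leftP := Fb; apply; split=> [n|]; first by have := e0 n; lra.
    by rewrite -[X in _ --> X]subr0; apply: cvgB => //; exact: cvg_cst.
  - have /cvg_at_rightP := Fa; apply; split=> [n|]; first by have := e0 n; lra.
    by rewrite -[X in _ --> X]addr0; apply: cvgD => //; exact: cvg_cst.
exact: (cvg_unique _ lim1 lim2).
Qed.

(** Common construction of both optimal distributions: [Qstar] has its atom at 0, [Fstar] at [V].
    The condition [B - A = 1 - w] makes the total mass one. *)
Lemma exists_atom_density_itv (R : realType) (w a l V A B : R) (g H : R -> R) :
  0 <= w -> l < V ->
  {in `]l, V[, forall x, 0 <= g x} -> {in `]l, V[, continuous g} ->
  {in `]l, V[, forall x : R, is_derive x 1 H (g x)} ->
  H x @[x --> l^'+] --> A -> H x @[x --> V^'-] --> B -> B - A = 1 - w ->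
  exists P : distr R,
  [/\ measurable_fun setT (g \_ `]l, V[),
      0 <= a <= V -> 0 <= l -> supported_in P V,
      forall f : R -> \bar R, measurable_fun setT f -> (forall x, 0 <= f x)%E ->
        (\int[P]_x f x = w%:E * f a + \int[@lebesgue_measure R]_x
           (f x * ((g \_ `]l, V[) x)%:E))%E &
      forall x, P `]-oo, x]%classic = (w * (a <= x)%R%:R +
        (if x <= l then 0 else if x < V then H x - A else 1 - w))%:E].
Proof.
move=> w0 lV g0 cg dH HA HB BA.
set g1 := g \_ `]l, V[.
have g1E x : g1 x = if l < x < V then g x else 0.
  by rewrite /g1 patchE mem_setE in_itv.
have g1_ge0 x : 0 <= g1 x.
  by rewrite g1E; case: ifP => // lxV; apply: g0; rewrite in_itv.
have mg1 : measurable_fun setT g1.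
  apply/(measurable_restrictT _ _).1; first exact: measurable_itv.
  by apply: open_continuous_measurable_fun => // x; rewrite inE; exact: cg.
have g1T : (\int[@lebesgue_measure R]_x (g1 x)%:E = (1 - w)%:E)%E.
  rewrite -BA -(ge0_FTC2_oo lV g0 cg dH HA HB) [RHS]integral_mkcond.
  apply: eq_integral => x _.
  by rewrite g1E patchE mem_setE in_itv/=; case: ifP.
have [P intP] := exists_atom_density a w0 g1_ge0 mg1 g1T.
exists P; split => // [/andP[a0 aV] l_ge0|x].
  rewrite /supported_in.
  transitivity (\int[P]_y (\1_(`[0, V]%classic) y)%:E)%E.
    by rewrite integral_indic// setIT.
  rewrite intP; last 2 first.
  - by apply/measurable_EFinP; exact: measurable_indic.
  - by move=> y; rewrite lee_fin.
  rewrite indicE mem_setE in_itv/= a0 aV mule1.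
  transitivity (w%:E + (1 - w)%:E)%E; last by rewrite -EFinD addrC subrK.
  congr (_ + _)%E; rewrite -g1T; apply: eq_integral => y _.
  rewrite indicE mem_setE in_itv/= g1E; case: ifP => [/andP[ly yV]|]; last by rewrite mule0.
  by rewrite !ltW ?mul1e//; exact: le_lt_trans ly.
transitivity (\int[P]_y (\1_(`]-oo, x]%classic) y)%:E)%E.
  by rewrite integral_indic// setIT.
rewrite intP; last 2 first.
- by apply/measurable_EFinP; exact: measurable_indic.
- by move=> y; rewrite lee_fin.
rewrite indicE mem_setE in_itv/= EFinD EFinM; congr (_ + _)%E.
have indE y : (\1_(`]-oo, x]%classic) y : R) = (y <= x)%R%:R.
  by rewrite indicE mem_setE in_itv.
under eq_integral do rewrite indE.
have [xl|lx] := leP x l.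
  apply: integral0_eq => y _; rewrite g1E.
  by have [yx|xy] := leP y x; rewrite /= ?mul0e// mul1e; case: ifP => // /andP[? ?]; exfalso; lra.
have [xV|Vx] := ltP x V; last first.
  rewrite -g1T; apply: eq_integral => y _; rewrite g1E.
  by have [yx|xy] := leP y x; rewrite /= ?mul0e ?mul1e//; case: ifP => // /andP[? ?]; exfalso; lra.
have sub : {subset `]l, x[ <= `]l, V[}.
  by move=> y; rewrite !in_itv/= => /andP[-> /lt_trans]; apply.
(* For [x] strictly between [l] and [V] the CDF comes from the fundamental theorem on []l, x[],
   where [H] is continuous at the right end. *)
have HX : H y @[y --> x^'-] --> H x.
  apply: cvg_at_left_filter; apply: differentiable_continuous.
  have dHx : is_derive x 1 H (g x) by apply: dH; rewrite in_itv/= lx xV.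
  by apply/derivable1_diffP; apply: ex_derive.
rewrite -(@ge0_FTC2_oo _ g H l x A (H x) lx) => [|y /sub|y /sub|y /sub||]//;
  [|exact: g0|exact: cg|exact: dH].
rewrite integral_itv_bndo_bndc; last first.
  apply/measurable_EFinP.
  apply: open_continuous_measurable_fun => // y; rewrite inE => /sub; exact: cg.
rewrite [RHS]integral_mkcond; apply: eq_integral => y _.
rewrite patchE mem_setE in_itv/= g1E.
case: (ltP l y) => ly /=; last by rewrite mule0.
have [yx|xy] := leP y x; last by rewrite mul0e.
by rewrite mul1e (le_lt_trans yx xV).
Qed.
(** * Revenue in terms of the survival function *)

Definition survival (R : realType) (F : distr R) (t : R) : R :=
  fine (F `]t, +oo[%classic).

Section survival.
Context (R : realType) (F : distr R).
Local Notation S := (survival F).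

Lemma survivalE t : (S t)%:E = F `]t, +oo[%classic.
Proof. by rewrite /survival fineK// fin_num_measure. Qed.

Lemma survival_ge0 t : 0 <= S t.
Proof. by rewrite -lee_fin survivalE. Qed.

Lemma survival_le1 t : S t <= 1.
Proof. by rewrite -lee_fin survivalE probability_le1. Qed.

Lemma measurable_survival : measurable_fun setT S.
Proof.
apply: nonincreasing_measurable => // s t st.
rewrite -lee_fin !survivalE le_measure ?inE//.
by apply: subset_itvr; rewrite bnd_simp.
Qed.

Lemma survival_cdf G t : has_cdf F G -> S t = 1 - G t.
Proof.
move=> /(_ t); rewrite /cdf/= /distribution/= /pushforward/= => Gt.
have {}Gt : F `]-oo, t]%classic = (G t)%:E by [].
by apply: EFin_inj; rewrite survivalE EFinB -Gt -setCitvl probability_setC.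
Qed.

Lemma supported_null V : supported_in F V -> F (~` `[0, V]%classic) = 0%E.
Proof. by move=> sF; rewrite probability_setC// sF subee. Qed.

Lemma survival_supported V t : supported_in F V -> V <= t -> S t = 0.
Proof.
move=> sF Vt; apply: EFin_inj; rewrite survivalE; apply/eqP.
rewrite eq_le measure_ge0 andbT.
rewrite -[X in (_ <= X)%E](supported_null sF) le_measure ?inE//; first exact: measurableC.
move=> x /=; rewrite !in_itv/= andbT => tx /andP[_ xV]; lra.
Qed.

End survival.

Lemma measurable_fun_natr_bool d (T : measurableType d) (R : realType)
    (D : set T) (b : T -> bool) :
  measurable_fun D b -> measurable_fun D (fun x => (b x)%:R : R).
Proof.
move=> mb.
have -> : (fun x => (b x)%:R : R) = (fun c : bool => c%:R : R) \o b by [].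
by apply: (measurable_comp (F := setT)) => //.
Qed.

Lemma measurable_payment (R : realType) (r : R) :
  measurable_fun [set: measurableTypeR R * measurableTypeR R] (@payment R r).
Proof.
rewrite /payment; apply: measurable_funM.
  apply: measurable_maxr => //; apply: measurable_minr => //.
apply: measurable_fun_natr_bool; apply: measurable_fun_ltr => //.
exact: measurable_maxr.
Qed.

(* [payment] retyped on the Borel spaces that carry the product measure, so that
   the coercion to a random variable is found. *)
Definition paymentRV (R : realType) (r : R) :
  measurableTypeR R * measurableTypeR R -> R := payment r.

HB.instance Definition _ (R : realType) (r : R) :=
  @isMeasurableFun.Build _ _ _ _ (@paymentRV R r) (measurable_payment r).

Section revenue_formula.
Context (R : realType) (F : distr R).
Local Notation S := (survival F).
Local Notation leb := (@lebesgue_measure R).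

Lemma prob_min_gt (t : R) :
  (F \x F)%E [set v | t < Num.min v.1 v.2] = (S t ^+ 2)%:E.
Proof.
have -> : [set v : R * R | t < Num.min v.1 v.2] =
    `]t, +oo[%classic `*` `]t, +oo[%classic.
  by apply/seteqP; split => -[x y] /=; rewrite !in_itv/= !andbT lt_min => /andP.
by rewrite expr2 EFinM !survivalE; exact: product_measure1E.
Qed.

(** The maximum fails to exceed [t] exactly when both independent values are at most [t], so this is
    [1 - (1 - S t) ^+ 2]. *)
Lemma prob_max_gt (t : R) :
  (F \x F)%E [set v | t < Num.max v.1 v.2] = (2 * S t - S t ^+ 2)%:E.
Proof.
have -> : [set v : R * R | t < Num.max v.1 v.2] =
    ~` (`]-oo, t]%classic `*` `]-oo, t]%classic).
  apply/seteqP; split => -[x y] /=; rewrite !in_itv/= lt_max.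
    by move=> /orP[h|h] [] h1 h2; lra.
  by move=> /not_andP[]/negP; rewrite -ltNge => ->//; rewrite orbT.
rewrite probability_setC; last exact: measurableX.
have FNt : F `]-oo, t]%classic = (1 - S t)%:E.
  by rewrite -setCitvr probability_setC// EFinB survivalE.
transitivity (1 - (1 - S t) * (1 - S t))%:E; last by congr EFin; ring.
rewrite EFinB EFinM -FNt; congr (1 - _)%E; exact: product_measure1E.
Qed.

(** The expectation of the nonnegative payment is the integral over [t >= 0] of the probability that
    it exceeds [t]. For [t < r] this event is a sale, so the maximum exceeds [r]; for [t >= r] it
    says that the minimum exceeds [t]. *)
Lemma reserve_revenue_ge0E (r : R) : 0 <= r ->
  reserve_revenue F r = ((r * (2 * S r - S r ^+ 2))%:E +
    \int[leb]_(t in `[0%R, +oo[) ((r <= t)%R%:R * S t ^+ 2)%:E)%E.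
Proof.
move=> r0; pose X : {RV (F \x F)%E >-> R} := paymentRV r.
rewrite /reserve_revenue -[payment r]/(X : _ -> R) ge0_expectation_ccdf; last first.
  by move=> v; rewrite /X/= /paymentRV /payment mulr_ge0// le_max r0.
transitivity (\int[leb]_(t in `[0%R, +oo[)
  (((t < r)%R%:R * (2 * S r - S r ^+ 2))%:E + ((r <= t)%R%:R * S t ^+ 2)%:E))%E.
  apply: eq_integral => t; rewrite inE/= in_itv/= andbT => t0.
  rewrite /ccdf/= /distribution/= /pushforward/=.
  have [tr|rt] := ltP t r.
    rewrite mul1r mul0r adde0 -prob_max_gt; congr (_ _).
    apply/seteqP; split => -[x y] /=; rewrite in_itv/= andbT /paymentRV /payment/=.
      by have [//|mr] := ltP r (Num.max x y); rewrite mulr0; lra.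
    by move=> ->; rewrite mulr1 lt_max tr.
  rewrite mul0r mul1r add0e -prob_min_gt; congr (_ _).
  apply/seteqP; split => -[x y] /=; rewrite in_itv/= andbT /paymentRV /payment/=.
    have [_|mr] := ltP r (Num.max x y); rewrite ?mulr0 ?mulr1 ?lt_max; last by lra.
    by move=> /orP[|//]; lra.
  move=> txy; have -> : r < Num.max x y.
    by move: txy; rewrite lt_min lt_max => /andP[tx ty]; apply/orP; left; lra.
  by rewrite mulr1 lt_max txy orbT.
rewrite ge0_integralD//=; last 4 first.
- move=> t _; rewrite lee_fin mulr_ge0//.
  by have := survival_ge0 F r; have := survival_le1 F r; nra.
- apply/measurable_EFinP; apply: measurable_funM => //.
  by apply: measurable_fun_natr_bool; apply: measurable_fun_ltr.
- by move=> t _; rewrite lee_fin mulr_ge0// exprn_ge0 ?survival_ge0.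
- apply/measurable_EFinP; apply: measurable_funM.
    by apply: measurable_fun_natr_bool; apply: measurable_fun_ler.
  by apply: measurable_funX; apply: measurable_funTS; exact: measurable_survival.
congr (_ + _)%E.
transitivity (\int[leb]_(t in `[0%R, r[) (2 * S r - S r ^+ 2)%:E)%E.
  rewrite integral_mkcond [RHS]integral_mkcond; apply: eq_integral => t _.
  rewrite !patchE/= !mem_setE !in_itv/= andbT.
  by case: (leP 0 t) => //=; case: ltP => //=; rewrite ?mul1r ?mul0r.
rewrite integral_cst//= lebesgue_measure_itv/= lte_fin.
move: r0; rewrite le_eqVlt => /predU1P[<-|r0]; first by rewrite ltxx mule0 mul0r.
by rewrite r0 sube0 -EFinM mulrC.
Qed.

(** Values are almost surely nonnegative, so a negative reserve never sets the price and yields the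
    same payment as reserve 0. *)
Lemma reserve_revenueE (V r : R) : supported_in F V ->
  reserve_revenue F r = reserve_revenue F (Num.max r 0).
Proof.
move=> sF; case: (leP 0 r) => // r0.
rewrite /reserve_revenue unlock; apply: ae_eq_integral => //.
- by apply/measurable_EFinP; exact: measurable_payment.
- by apply/measurable_EFinP; exact: measurable_payment.
pose A : set R := `[0, V]%classic.
have mA : measurable A by exact: measurable_itv.
exists (~` (A `*` A)); split.
- by apply: measurableC; apply: measurableX.
- transitivity (1 - (F \x F) (A `*` A))%E.
    by apply: probability_setC; exact: measurableX.
  transitivity (1 - 1 : \bar R)%E; last by rewrite subee.
  congr (1 - _)%E; transitivity (F A * F A)%E; first exact: product_measure1E.
  by rewrite sF mule1.
- move=> [x y]/=; apply: contra_not => -[]; rewrite /A/= !in_itv/=.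
  move=> /andP[x0 _] /andP[y0 _] _; rewrite /payment/=; congr EFin.
  have m0 : 0 <= Num.min x y by rewrite le_min x0.
  rewrite (max_idPr m0) (max_idPr _); last by lra.
  have -> : r < Num.max x y by rewrite lt_max; apply/orP; left; lra.
  (* If both values are 0, the negative reserve sells at price 0 while reserve 0 does not sell; the
     payment is 0 either way. *)
  have [//|M0] := ltP 0 (Num.max x y).
  have -> : Num.min x y = 0.
    apply/eqP; rewrite eq_le m0 andbT; move: M0; rewrite ge_max => /andP[xx yy].
    by rewrite ge_min xx.
  by rewrite !mul0r.
Qed.

End revenue_formula.

(** * Mean as an integral of survival, and measurability of the revenue in the reserve *)

Section expectation_survival.
Context (R : realType) (F : distr R) (V : R).
Hypothesis sF : supported_in F V.
Local Notation S := (survival F).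
Local Notation leb := (@lebesgue_measure R).

Lemma expectation_survival :
  ('E_F[@idRV R] = \int[leb]_(t in `[0%R, +oo[) (S t)%:E)%E.
Proof.
pose X : {RV F >-> R} := (@idRV R)^\+.
transitivity ('E_F[X])%E.
  rewrite unlock; apply: ae_eq_integral => //.
  - exact/measurable_EFinP.
  - by apply/measurable_EFinP; exact: measurable_funP.
  exists (~` `[0, V]%classic); split; first exact: measurableC.
  - exact: supported_null.
  - move=> x /=; apply: contra_not; rewrite in_itv/= => /andP[x0 _] _.
    by congr EFin; rewrite /X /funrpos/= max_l.
rewrite ge0_expectation_ccdf => [|x]; last exact: funrpos_ge0.
apply: eq_integral => t; rewrite inE/= in_itv/= andbT => t0.
rewrite survivalE; congr (F _); apply/seteqP; split => x /=;
  rewrite !in_itv/= !andbT /X /funrpos/= lt_max /idRV/=.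
- by move=> /orP[//|]; lra.
- by move=> ->.
Qed.

(** The integrand of the revenue formula as a function of the pair (reserve, level). Indicators
    replace the integration domain, so that Tonelli applies on the whole plane. *)
Let kernel (z : R * R) : \bar R :=
  ((0 <= z.2)%R%:R * (Num.max z.1 0 <= z.2)%R%:R * S z.2 ^+ 2)%:E.

Let measurable_kernel : measurable_fun [set: R * R] kernel.
Proof.
apply/measurable_EFinP; apply: measurable_funM; first apply: measurable_funM.
- by apply: measurable_fun_natr_bool; apply: measurable_fun_ler.
- apply: measurable_fun_natr_bool; apply: measurable_fun_ler => //.
  exact: measurable_maxr.
- apply: measurable_funX; apply: measurableT_comp => //.
  exact: measurable_survival.
Qed.

Let kernel_ge0 z : (0 <= kernel z)%E.
Proof. by rewrite lee_fin mulr_ge0 ?sqr_ge0// mulr_ge0. Qed.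

Lemma reserve_revenue_maxE (r : R) : let m := Num.max r 0 in
  reserve_revenue F r = ((m * (2 * S m - S m ^+ 2))%:E +
    \int[leb]_t ((0 <= t)%R%:R * (m <= t)%R%:R * S t ^+ 2)%:E)%E.
Proof.
move=> m; rewrite (reserve_revenueE r sF) reserve_revenue_ge0E; last first.
  by rewrite le_max lexx orbT.
congr (_ + _)%E; rewrite integral_mkcond; apply: eq_integral => t _.
rewrite patchE mem_setE in_itv/= andbT.
by case: ifP => _; rewrite ?mul1r ?mul0r.
Qed.

Lemma reserve_revenue_ge0 r : (0 <= reserve_revenue F r)%E.
Proof.
rewrite reserve_revenue_maxE; apply: adde_ge0.
  rewrite lee_fin mulr_ge0//; first by rewrite le_max lexx orbT.
  set m := Num.max r 0.
  by have := survival_ge0 F m; have := survival_le1 F m; nra.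
by apply: integral_ge0 => t _; exact: kernel_ge0 (r, t).
Qed.

Lemma measurable_reserve_revenue : measurable_fun setT (reserve_revenue F).
Proof.
rewrite (_ : reserve_revenue F = fun r => (((Num.max r 0) *
    (2 * S (Num.max r 0) - S (Num.max r 0) ^+ 2))%:E +
    fubini_F leb kernel r)%E); last first.
  by apply/funext => r; rewrite reserve_revenue_maxE.
have mm : measurable_fun setT (fun r : R => Num.max r 0).
  exact: measurable_maxr.
have mS : measurable_fun setT (fun r : R => S (Num.max r 0)).
  by apply: measurableT_comp => //; exact: measurable_survival.
apply: emeasurable_funD; last exact: measurable_fun_fubini_tonelli_F.
apply/measurable_EFinP; apply: measurable_funM => //; apply: measurable_funB.
  exact: measurable_funM.
exact: measurable_funX.
Qed.

End expectation_survival.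

(** * Revenue of a random reserve with an atom at 0 and a density *)

(** Exchanging the integrals over the reserve [r] and the level [t] leaves, as factor of [S t ^+ 2],
    the mass of the reserves at most [t], which is [Qc t]. *)
Lemma revenue_atom_density (R : realType) (F Q : distr R) (V c : R)
    (q Qc : R -> R) :
  supported_in F V -> has_cdf Q Qc ->
  0 <= c -> (forall x, 0 <= q x) -> (forall x, x < 0 -> q x = 0) ->
  measurable_fun setT q ->
  (forall f : R -> \bar R, measurable_fun setT f -> (forall x, 0 <= f x)%E ->
    (\int[Q]_x f x = c%:E * f 0%R +
      \int[@lebesgue_measure R]_x (f x * (q x)%:E))%E) ->
  (revenue F Q = \int[@lebesgue_measure R]_(t in `[0%R, +oo[)
     (t * q t * (2 * survival F t - survival F t ^+ 2) +
      Qc t * survival F t ^+ 2)%:E)%E.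
Proof.
move=> sF cdfQ c0 q0 qneg mq intQ.
set S := survival F; set leb := @lebesgue_measure R.
have mS : measurable_fun setT S by exact: measurable_survival.
have S0 t : 0 <= S t by exact: survival_ge0.
have S1 t : S t <= 1 by exact: survival_le1.
have L0 t : 0 <= 2 * S t - S t ^+ 2 by have := S0 t; have := S1 t; nra.
have mL : measurable_fun setT (fun t => 2 * S t - S t ^+ 2).
  by apply: measurable_funB; [exact: measurable_funM|exact: measurable_funX].
pose ind (r t : R) : R := (0 <= t)%R%:R * (r <= t)%R%:R * S t ^+ 2.
have ind0 r t : 0 <= ind r t by rewrite mulr_ge0 ?sqr_ge0// mulr_ge0.
have mind r : measurable_fun setT (ind r).
  apply: measurable_funM; last exact: measurable_funX.
  by apply: measurable_funM; apply: measurable_fun_natr_bool;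
    apply: measurable_fun_ler.
have QcE t : 0 <= t ->
    ((Qc t)%:E = c%:E + \int[leb]_r (((r <= t)%R)%:R * q r)%:E)%E.
  move=> t0; rewrite -cdfQ.
  transitivity (\int[Q]_r ((r <= t)%R%:R)%:E)%E.
    rewrite /cdf/= /distribution/= /pushforward/=.
    rewrite -[LHS]/(Q `]-oo, t]%classic) -[in LHS](setIT `]-oo, t]%classic).
    rewrite -integral_indic//; apply: eq_integral => x _.
    by rewrite indicE mem_setE in_itv.
  rewrite intQ.
  - by rewrite t0 mule1; congr (_ + _)%E; apply: eq_integral.
  - apply/measurable_EFinP; apply: measurable_fun_natr_bool.
    exact: measurable_fun_ler.
  - by move=> x; rewrite lee_fin.
rewrite /revenue intQ; [|exact: measurable_reserve_revenue sF|
  exact: reserve_revenue_ge0 sF].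
(* At the atom the reserve is 0, so only the integral of [S t ^+ 2] remains. *)
rewrite (reserve_revenue_maxE sF) maxxx mul0r add0e.
have -> : (\int[leb]_r (reserve_revenue F r * (q r)%:E) =
    \int[leb]_r ((r * q r * (2 * S r - S r ^+ 2))%:E +
      \int[leb]_t (q r * ind r t)%:E))%E.
  apply: eq_integral => r _; rewrite (reserve_revenue_maxE sF).
  have [r0|r0] := ltP r 0.
    rewrite qneg// mule0 mulr0 mul0r add0e; apply/esym.
    by apply: integral0_eq => t _; rewrite mul0r.
  rewrite ge0_muleDl ?lee_fin ?mulr_ge0//; last first.
    by apply: integral_ge0 => t _; rewrite lee_fin ind0.
  rewrite -EFinM; congr (_%:E + _)%E; first by rewrite -/S; ring.
  rewrite muleC -ge0_integralZl//.
  - by apply/measurable_EFinP; exact: mind.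
  - by move=> t _; rewrite lee_fin ind0.
  - by rewrite lee_fin.
have mk : measurable_fun [set: R * R] (fun z => (q z.1 * ind z.1 z.2)%:E).
  apply/measurable_EFinP; apply: measurable_funM.
    exact: (measurableT_comp mq measurable_fst).
  apply: measurable_funM; first apply: measurable_funM.
  - by apply: measurable_fun_natr_bool; apply: measurable_fun_ler.
  - by apply: measurable_fun_natr_bool; apply: measurable_fun_ler.
  - by apply: measurable_funX; exact: (measurableT_comp mS measurable_snd).
have k0 z : (0 <= (q z.1 * ind z.1 z.2)%:E)%E by rewrite lee_fin mulr_ge0.
have rq0 r : 0 <= r * q r * (2 * S r - S r ^+ 2).
  apply: mulr_ge0 => //.
  by have [r0|r0] := ltP r 0; [rewrite qneg// mulr0|rewrite mulr_ge0].
have mrq : measurable_fun setT (fun r : R => r * q r * (2 * S r - S r ^+ 2)).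
  by apply: measurable_funM => //; apply: measurable_funM.
rewrite ge0_integralD//; last 4 first.
- by move=> r _; rewrite lee_fin.
- exact/measurable_EFinP.
- by move=> r _; apply: integral_ge0 => t _; exact: k0 (r, t).
- exact: (measurable_fun_fubini_tonelli_F (m2 := leb) _ mk k0).
have -> : (\int[leb]_r \int[leb]_t (q r * ind r t)%:E =
    \int[leb]_t \int[leb]_r (q r * ind r t)%:E)%E.
  exact: (fubini_tonelli (m1 := leb) (m2 := leb) _ mk k0).
have mG : measurable_fun setT (fun t => \int[leb]_r (q r * ind r t)%:E)%E.
  exact: (measurable_fun_fubini_tonelli_G (m1 := leb) _ mk k0).
rewrite addeCA -ge0_integralZl//; last 2 first.
- by apply/measurable_EFinP; exact: (mind 0).
- by move=> t _; rewrite lee_fin; exact: ind0.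
have mc : measurable_fun setT (fun t => c%:E * (ind 0 t)%:E)%E.
  by apply/measurable_EFinP; apply: measurable_funM => //; exact: mind.
have c_ind0 t : (0 <= c%:E * (ind 0 t)%:E)%E by rewrite mule_ge0// lee_fin.
have G0 t : (0 <= \int[leb]_r (q r * ind r t)%:E)%E.
  by apply: integral_ge0 => r _; exact: k0 (r, t).
rewrite -ge0_integralD; [|by []|by move=> t _; exact: c_ind0|exact: mc|
  by move=> t _; exact: G0|exact: mG].
(* All terms are now integrals over [t] and are merged into one; the rest is an identity for each
   [t], in which [QcE] collects atom and density. *)
rewrite -ge0_integralD; [|by []|by move=> t _; rewrite lee_fin|
  exact/measurable_EFinP|
  by move=> t _; apply: adde_ge0; [exact: c_ind0|exact: G0]|
  exact: emeasurable_funD].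
rewrite [RHS]integral_mkcond; apply: eq_integral => t _.
rewrite patchE mem_setE in_itv/= andbT.
have [t0|t0] := leP 0 t; last first.
  rewrite qneg// mulr0 mul0r add0e /ind (lt_geF t0) !mul0r mule0 add0e.
  apply: integral0_eq => r _.
  by rewrite !mul0r mulr0.
rewrite -[RHS]/((t * q t * (2 * S t - S t ^+ 2))%:E +
  (Qc t)%:E * (S t ^+ 2)%:E)%E QcE// ge0_muleDl ?lee_fin//; last first.
  by apply: integral_ge0 => r _; rewrite lee_fin mulr_ge0.
congr (_ + (_ + _))%E; first by rewrite !mul1r.
rewrite muleC -ge0_integralZl ?lee_fin ?exprn_ge0//.
- apply: eq_integral => r _; rewrite -EFinM; congr EFin.
  by rewrite /ind t0 mul1r mulrA mulrC (mulrC (q r)).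
- apply/measurable_EFinP; apply: measurable_funM => //.
  by apply: measurable_fun_natr_bool; apply: measurable_fun_ler.
- by move=> r _; rewrite lee_fin mulr_ge0.
Qed.

(** * The cutoff and the reserve distribution *)

(** This is [1 + u < expR u] for [u = ln (y / x)], multiplied by [x]. *)
Lemma lt_mul_ln_sub (R : realType) (x y : R) : 0 < x -> 0 < y -> x != y ->
  x * (ln y - ln x) < y - x.
Proof.
move=> x0 y0 xy; have u0 : ln y - ln x != 0.
  by rewrite subr_eq0; apply: contra xy => /eqP/ln_inj ->.
have := expR_gt1Dx u0; rewrite -ln_div ?posrE// lnK ?posrE ?divr_gt0//.
by rewrite ltr_pdivlMr//; lra.
Qed.

Lemma le_mul_ln_sub (R : realType) (x y : R) : 0 < x -> 0 < y ->
  x * (ln y - ln x) <= y - x.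
Proof.
move=> x0 y0; have [->|xy] := eqVneq x y; first by rewrite !subrr mulr0.
exact/ltW/lt_mul_ln_sub.
Qed.

(** The expression is the mean of [Fstar] with cutoff [x]. The difference of the two sides is [(y -
    x - x * (ln y - ln x)) + (y - x) * (ln V - ln y)], whose first term is positive and second
    nonnegative. *)
Lemma equal_revenue_mean_lt (R : realType) (V x y : R) :
  0 < x -> x < y -> y <= V ->
  x * (1 + ln V - ln x) < y * (1 + ln V - ln y).
Proof.
move=> x0 xy yV; have y0 : 0 < y by lra.
have h1 : x * (ln y - ln x) < y - x by apply: lt_mul_ln_sub => //; rewrite lt_eqF.
have h2 : ln y <= ln V by rewrite ler_ln ?posrE//; lra.
have : 0 <= (y - x) * (ln V - ln y) by rewrite mulr_ge0//; lra.
by lra.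
Qed.

Lemma exists_unique_vlow (R : realType) (mu V : R) : 0 < mu -> mu < V ->
  exists! l, is_vlow mu V l.
Proof.
move=> mu0 muV; have V0 : 0 < V by lra.
pose phi x := x * (1 + ln V - ln x).
have phi_lt x y : 0 < x -> x < y -> y <= V -> phi x < phi y.
  exact: equal_revenue_mean_lt.
(* The left end [s * (s * V)] for the intermediate value theorem is positive, and the logarithmic
   bound for [s * V] and [V] gives [phi (s * (s * V)) <= s * (2 * V - s * V) <= 2 * s * V = mu]. *)
pose s := mu / (2 * V).
have sV : 2 * (s * V) = mu by rewrite /s; field; lra.
have s0 : 0 < s by rewrite divr_gt0// mulr_gt0.
have sV0 : 0 < s * V by rewrite mulr_gt0.
have x00 : 0 < s * (s * V) by rewrite mulr_gt0.
have s1 : s < 1 by rewrite /s ltr_pdivrMr; lra.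
have x0V : s * (s * V) < V.
  by rewrite (@lt_trans _ _ (s * V))// ?gtr_pMl// ; lra.
have phix0 : phi (s * (s * V)) <= mu.
  have : (s * V) * (ln V - ln (s * V)) <= V - s * V by exact: le_mul_ln_sub.
  have e1 : ln (s * V) = ln s + ln V by rewrite lnM ?posrE.
  have e2 : ln (s * (s * V)) = ln s + ln s + ln V by rewrite lnM ?posrE// e1 addrA.
  rewrite /phi e1 e2 => h.
  have := ler_wpM2l (ltW s0) h; rewrite -sV; nra.
have phiV : phi V = V by rewrite /phi addrK mulr1.
have [l] : exists2 c, c \in `[s * (s * V), V] & phi c = mu.
  apply: IVT; first exact: ltW.
  - apply: continuous_in_subspaceT => x; rewrite inE/= in_itv/= => /andP[xx _].
    have x0 : 0 < x by lra.
    apply: cvgM; first exact: cvg_id.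
    by apply: cvgB; [exact: cvg_cst|exact: continuous_ln].
  - rewrite phiV ge_min le_max phix0/=.
    by apply/orP; right; lra.
rewrite in_itv/= => /andP[l0 lV] phil.
exists l; split; first by split => //; apply/andP; split; lra.
move=> m [/andP[m0 mV]]; rewrite -/(phi m) -phil => phim.
apply/eqP; rewrite eq_le; apply/andP; split; rewrite leNgt; apply/negP => h.
  have := phi_lt _ _ m0 h lV; lra.
have l0' : 0 < l by lra.
have := phi_lt _ _ l0' h mV; lra.
Qed.

Section equilibrium_functions.
Context (R : realType) (l V : R).
Hypotheses (l0 : 0 < l) (lV : l < V).

Let V0 : 0 < V. Proof. exact: lt_trans lV. Qed.

(** The constant value of [Qstar] on [[0, l]], hence its mass at 0. Below, [Qmain] is the branch of
    [Qstar] above [l], and [Qdensity] is its derivative. *)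
Definition Qatom : R := (1 - l / V) * (1 / (ln V - ln l)).

Definition Qdensity (t : R) : R :=
  Qatom * (t - l - l * (ln t - ln l)) / (t - l) ^+ 2.

Definition Qmain (t : R) : R := Qatom * (t / (t - l)) * (ln t - ln l).

Lemma lnV_gt_lnl : 0 < ln V - ln l.
Proof. by rewrite subr_gt0 ltr_ln ?posrE. Qed.

Lemma Qatom_gt0 : 0 < Qatom.
Proof.
rewrite /Qatom mulr_gt0 ?divr_gt0 ?lnV_gt_lnl//.
by rewrite subr_gt0 ltr_pdivrMr ?mul1r.
Qed.

Lemma Qdensity_ge0 t : l < t -> 0 <= Qdensity t.
Proof.
move=> lt; rewrite divr_ge0 ?sqr_ge0// mulr_ge0 ?(ltW Qatom_gt0)//.
by rewrite subr_ge0; apply: le_mul_ln_sub => //; exact: lt_trans lt.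
Qed.

Lemma continuous_Qdensity t : l < t -> {for t, continuous Qdensity}.
Proof.
move=> lt; have tl0 : (t - l) ^+ 2 != 0 by rewrite expf_neq0// subr_eq0 gt_eqF.
have ct : (s - l) @[s --> t] --> t - l by apply: cvgB; [exact: cvg_id|exact: cvg_cst].
apply: cvgM; last by apply: cvgV => //; apply: cvgM.
apply: cvgM; first exact: cvg_cst.
apply: cvgB => //; apply: cvgM; first exact: cvg_cst.
apply: cvgB; last exact: cvg_cst.
by apply: continuous_ln; exact: lt_trans lt.
Qed.

Lemma is_derive_Qmain (t : R) : l < t -> is_derive t 1 Qmain (Qdensity t).
Proof.
move=> lt; have tl0 : t - l != 0 by rewrite subr_eq0 gt_eqF.
have t0 := lt_trans l0 lt.
have d1 : is_derive t 1 (fun s : R => s - l) 1.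
  by apply: is_derive_eq (subr0 _).
have d2 : is_derive t 1 (fun s : R => (s - l)^-1) (- (t - l) ^- 2 *: 1).
  exact: (@is_deriveV _ (fun s : R => s - l)).
have d3 := is_derive1_ln t0.
have d4 := is_deriveM (is_deriveM (is_derive_cst Qatom t 1)
  (is_deriveM (is_derive_id t 1) d2)) (is_deriveB d3 (is_derive_cst (ln l) t 1)).
have -> : Qmain = (cst Qatom * (id * (fun s => (s - l)^-1)) *
    (@ln R - cst (ln l)))%R.
  by apply/funext => s; rewrite /Qmain.
apply: (is_derive_eq d4).
rewrite !fctE /Qdensity /GRing.scale/= /GRing.scale/=.
by field; rewrite tl0 gt_eqF.
Qed.

(** The two logarithmic bounds squeeze [Qmain t] between [Qatom] and [Qatom * (t / l)]. Thus [Qstar]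
    has no jump at [l]. *)
Lemma Qmain_cvg_right : Qmain t @[t --> l^'+] --> Qatom.
Proof.
apply: (@squeeze_cvgr _ _ _ _ (fun=> Qatom) (fun t => Qatom * (t / l))).
- near=> t; have lt : l < t by near: t; exact: nbhs_right_gt.
  have t0 := lt_trans l0 lt.
  have tl : 0 < t - l by lra.
  have c0 := Qatom_gt0; have l0' := l0.
  have h1 := le_mul_ln_sub l0 t0; have h2 := le_mul_ln_sub t0 l0.
  rewrite /Qmain -mulrA; apply/andP; split; last first.
    rewrite ler_pM2l// mulrAC ler_pdivrMr// -mulrA ler_pM2l// mulrC.
    by rewrite ler_pdivlMr// mulrC.
  by rewrite ler_pMr// mulrAC ler_pdivlMr// mul1r; lra.
- exact: cvg_cst.
- rewrite -[X in _ --> X]mulr1 -(divff (lt0r_neq0 l0)); apply: cvgM; first exact: cvg_cst.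
  by apply: cvgM; [exact: cvg_at_right_filter cvg_id|exact: cvg_cst].
Unshelve. all: by end_near. Qed.

Lemma Qmain_V : Qmain V = 1.
Proof.
rewrite /Qmain /Qatom; field.
by rewrite !gt_eqF ?subr_gt0 ?lnV_gt_lnl// -subr_gt0 lnV_gt_lnl.
Qed.

Lemma Qmain_cvg_left : Qmain t @[t --> V^'-] --> (1 : R).
Proof.
rewrite -Qmain_V; apply: cvg_at_left_filter; apply: differentiable_continuous.
by apply/derivable1_diffP; have := is_derive_Qmain lV => h; apply: ex_derive.
Qed.

(** As a quadratic in [S], the revenue integrand is [2 * (t * q) * S + (Qmain - t * q) * S ^+ 2].
    The first claim is its convexity, the second that half its slope at [S = l / t] is [Qatom]. *)
Lemma Qstar_high_tangent (t : R) : l < t ->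
  0 <= Qmain t - t * Qdensity t /\
  t * Qdensity t + (Qmain t - t * Qdensity t) * (l / t) = Qatom.
Proof.
move=> lt; have tl0 : t - l != 0 by rewrite subr_eq0 gt_eqF.
have t0 := lt_trans l0 lt.
split; last first.
  by rewrite /Qmain /Qdensity; field; rewrite tl0 gt_eqF.
have -> : Qmain t - t * Qdensity t =
    Qatom * t / (t - l) ^+ 2 * (l - t - t * (ln l - ln t)).
  by rewrite /Qmain /Qdensity; field.
apply: mulr_ge0; last by rewrite subr_ge0; exact: le_mul_ln_sub.
by rewrite divr_ge0 ?sqr_ge0// mulr_ge0 ?ltW// Qatom_gt0.
Qed.

End equilibrium_functions.

(** * Integrals of the survival function of [Fstar] and of its square *)

Lemma is_derive_sub_div (R : realType) (k j t : R) : t != 0 ->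
  is_derive t 1 (fun s => k - j / s) (j / t ^+ 2).
Proof.
move=> t0; have d1 : is_derive t 1 (fun s : R => s^-1) (- t ^- 2 *: 1).
  exact: (@is_deriveV _ id).
have d2 := is_deriveB (is_derive_cst k t 1)
  (is_deriveM (is_derive_cst j t 1) d1).
have -> : (fun s => k - j / s) = (cst k - cst j * (fun s : R => s^-1))%R.
  exact/funext.
apply: (is_derive_eq d2); rewrite !fctE /GRing.scale/= /GRing.scale/=.
by field.
Qed.

Lemma continuous_div_sqr (R : realType) (j t : R) : t != 0 ->
  {for t, continuous (fun s : R => j / s ^+ 2)}.
Proof.
move=> t0; apply: cvgM; first exact: cvg_cst.
by apply: cvgV; [exact: expf_neq0|apply: cvgM; exact: cvg_id].
Qed.

Lemma integral_div_sqr (R : realType) (j m V : R) : 0 <= j -> 0 < m -> m < V ->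
  (\int[@lebesgue_measure R]_(t in `]m, V[) (j / t ^+ 2)%:E =
   (j / m - j / V)%:E)%E.
Proof.
move=> j0 m0 mV; have V0 : 0 < V by lra.
have cont (t : R) : 0 < t -> {for t, continuous (fun s : R => 0 - j / s)}.
  move=> t0; apply: differentiable_continuous; apply/derivable1_diffP.
  by have h := is_derive_sub_div 0 j (lt0r_neq0 t0); apply: ex_derive.
rewrite (_ : j / m - j / V = (0 - j / V) - (0 - j / m)); last by ring.
apply: (@ge0_FTC2_oo _ _ (fun t => 0 - j / t)) => //.
- by move=> t _; rewrite divr_ge0// sqr_ge0.
- move=> t; rewrite in_itv/= => /andP[mt _].
  by apply: continuous_div_sqr; rewrite lt0r_neq0//; lra.
- move=> t; rewrite in_itv/= => /andP[mt _].
  by apply: is_derive_sub_div; rewrite lt0r_neq0//; lra.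
- exact/cvg_at_right_filter/cont.
- exact/cvg_at_left_filter/cont.
Qed.

Lemma integral_div (R : realType) (j m V : R) : 0 <= j -> 0 < m -> m < V ->
  (\int[@lebesgue_measure R]_(t in `]m, V[) (j / t)%:E =
   (j * (ln V - ln m))%:E)%E.
Proof.
move=> j0 m0 mV; have V0 : 0 < V by lra.
have cont (t : R) : 0 < t -> {for t, continuous (fun s : R => j * ln s)}.
  by move=> t0; apply: cvgM; [exact: cvg_cst|exact: continuous_ln].
rewrite mulrBr; apply: (@ge0_FTC2_oo _ _ (fun t => j * ln t)) => //.
- by move=> t; rewrite in_itv/= => /andP[mt _]; rewrite divr_ge0//; lra.
- move=> t; rewrite in_itv/= => /andP[mt _].
  apply: cvgM; first exact: cvg_cst.
  by apply: cvgV; [rewrite lt0r_neq0//; lra|exact: cvg_id].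
- move=> t; rewrite in_itv/= => /andP[mt _].
  have t0 : 0 < t by lra.
  have d := is_deriveM (is_derive_cst j t 1) (is_derive1_ln t0).
  have -> : (fun s => j * ln s) = (cst j * @ln R)%R by exact/funext.
  apply: (is_derive_eq d); rewrite !fctE /GRing.scale/= /GRing.scale/=.
  by rewrite mulr0 addr0.
- exact/cvg_at_right_filter/cont.
- exact/cvg_at_left_filter/cont.
Qed.

(** Cuts the half-line at the points where the survival function of [Fstar] changes its formula. *)
Lemma integral_bndy_split (R : realType) (f : R -> \bar R) (a b V : R) :
  measurable_fun setT f -> (forall x, 0 <= f x)%E -> a <= b -> b < V ->
  (\int[@lebesgue_measure R]_(t in `[a, +oo[) f t =
   \int[@lebesgue_measure R]_(t in `[a, b]) f t +
   (\int[@lebesgue_measure R]_(t in `]b, V[) f t +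
    \int[@lebesgue_measure R]_(t in `[V, +oo[) f t))%E.
Proof.
move=> mf f0 ab bV.
rewrite (@itv_bndbnd_setU _ _ (BLeft a) (BRight b) +oo%O)//=.
rewrite ge0_integral_setU//=; last 2 first.
- exact: measurable_funTS.
- apply/disj_setPS => x /= []; rewrite !in_itv/= andbT => /andP[_ xb] bx.
  by lra.
congr (_ + _)%E.
rewrite (@itv_bndbnd_setU _ _ (BRight b) (BLeft V) +oo%O)//=.
rewrite ge0_integral_setU//=; first exact: measurable_funTS.
apply/disj_setPS => x /= []; rewrite !in_itv/= andbT => /andP[_ xV] Vx.
by lra.
Qed.

(** * Equilibrium *)

Section equilibrium.
Context (R : realType) (mu V l : R).
Hypotheses (l0 : 0 < l) (lV : l < V).
Hypothesis l_mean : l * (1 + ln V - ln l) = mu.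
Local Notation leb := (@lebesgue_measure R).
Local Notation c := (Qatom l V).
Local Notation q := (Qdensity l V \_ `]l, V[).

Let V0 : 0 < V. Proof. exact: lt_trans lV. Qed.

Lemma exists_Qstar : exists Qs : distr R,
  [/\ measurable_fun setT q, supported_in Qs V,
      forall f : R -> \bar R, measurable_fun setT f -> (forall x, 0 <= f x)%E ->
        (\int[Qs]_x f x = c%:E * f 0%R + \int[leb]_x (f x * (q x)%:E))%E &
      has_cdf Qs (Qstar V l)].
Proof.
have c0 := Qatom_gt0 l0 lV.
have [||||||Qs [mq sQ intQ cdfQ]] := @exists_atom_density_itv R c 0 l V c 1
    (Qdensity l V) (Qmain l V) (ltW c0) lV.
- by move=> t; rewrite in_itv/= => /andP[lt _]; exact: Qdensity_ge0.
- by move=> t; rewrite in_itv/= => /andP[lt _]; exact: continuous_Qdensity.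
- by move=> t; rewrite in_itv/= => /andP[lt _]; exact: is_derive_Qmain.
- exact: Qmain_cvg_right.
- exact: Qmain_cvg_left.
- by [].
exists Qs; split => //; first by apply: sQ; rewrite ?lexx ltW.
move=> x; rewrite /cdf/= /distribution/= /pushforward/=.
rewrite -[LHS]/(Qs `]-oo, x]%classic) cdfQ; congr EFin; rewrite /Qstar.
have [x0|x0] := ltP x 0.
  by rewrite (ltW (lt_trans x0 l0)) mulr0 addr0.
have [xl|lx] := leP x l; first by rewrite mulr1 addr0.
rewrite mulr1; have [xV|Vx] := ltP x V.
  rewrite (ltW xV) addrC subrK /Qmain /Qatom; ring.
rewrite addrC subrK; have [xV|//] := leP x V.
have -> : x = V by apply/eqP; rewrite eq_le xV.
rewrite -[LHS](Qmain_V l0 lV) /Qmain /Qatom; ring.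
Qed.

Lemma exists_Fstar : exists Fs : distr R,
  supported_in Fs V /\ has_cdf Fs (Fstar V l).
Proof.
have w0 : 0 <= l / V by rewrite divr_ge0 ?ltW.
have cont (t : R) : 0 < t -> {for t, continuous (fun s : R => 1 - l / s)}.
  move=> t0; apply: differentiable_continuous; apply/derivable1_diffP.
  by have h := is_derive_sub_div 1 l (lt0r_neq0 t0); apply: ex_derive.
(* The atom [l / V] at [V] is the mass that [1 - l / t] leaves there. The limit 0 at [l] is written
   [1 - l / l], so that it follows from continuity. *)
have [||||||Fs [_ sF _ cdfF]] := @exists_atom_density_itv R (l / V) V l V
    (1 - l / l) (1 - l / V) (fun t => l / t ^+ 2) (fun t => 1 - l / t) w0 lV.
- by move=> t _; rewrite divr_ge0 ?sqr_ge0 ?ltW.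
- move=> t; rewrite in_itv/= => /andP[lt _].
  by apply: continuous_div_sqr; rewrite lt0r_neq0//; exact: lt_trans lt.
- move=> t; rewrite in_itv/= => /andP[lt _].
  by apply: is_derive_sub_div; rewrite lt0r_neq0//; exact: lt_trans lt.
- exact/cvg_at_right_filter/cont.
- exact/cvg_at_left_filter/cont.
- by rewrite divff ?lt0r_neq0// subrr subr0.
exists Fs; split; first by apply: sF; rewrite ?lexx ?andbT ltW.
move=> x; rewrite /cdf/= /distribution/= /pushforward/=.
rewrite -[LHS]/(Fs `]-oo, x]%classic) cdfF; congr EFin; rewrite /Fstar.
have [xV|Vx] := ltP x V; last first.
  by rewrite leNgt (lt_le_trans lV Vx) mulr1/= addrC subrK.
rewrite mulr0 add0r; case: ifP => // _.
by rewrite divff ?lt0r_neq0// subrr subr0.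
Qed.

(** * Mean of [Fstar] and revenue of reserves against it *)

Section fixed_equilibrium.
Variables (Fs Qs : distr R).
Hypotheses (sFs : supported_in Fs V) (cdfFs : has_cdf Fs (Fstar V l)).
Hypothesis cdfQs : has_cdf Qs (Qstar V l).
Hypothesis mq : measurable_fun setT q.
Hypothesis intQs : forall f : R -> \bar R, measurable_fun setT f ->
  (forall x, 0 <= f x)%E ->
  (\int[Qs]_x f x = c%:E * f 0%R + \int[leb]_x (f x * (q x)%:E))%E.

Local Notation Ss := (survival Fs).

Lemma survival_FstarE t : Ss t = if t < V then if t <= l then 1 else l / t else 0.
Proof.
rewrite (survival_cdf t cdfFs) /Fstar; case: ifP => _; last by rewrite subrr.
by case: ifP => _; rewrite ?subr0// opprB addrC subrK.
Qed.

Lemma survival_Fstar_low t : t <= l -> Ss t = 1.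
Proof. by move=> tl; rewrite survival_FstarE (le_lt_trans tl lV) tl. Qed.

Lemma survival_Fstar_mid t : l < t -> t < V -> Ss t = l / t.
Proof. by move=> lt tV; rewrite survival_FstarE tV leNgt lt. Qed.

Lemma survival_Fstar_high t : V <= t -> Ss t = 0.
Proof. by move=> Vt; rewrite survival_FstarE ltNge Vt. Qed.

(** The survival function integrates to [l] below the cutoff and to [l * (ln V - ln l)] above it;
    the equation defining the cutoff makes the sum [mu]. *)
Lemma expectation_Fstar : ('E_Fs[@idRV R] = mu%:E)%E.
Proof.
rewrite (expectation_survival sFs) (@integral_bndy_split _ _ _ l V) ?(ltW l0)//.
- rewrite (eq_integral (cst 1%E)); last first.
    by move=> t; rewrite inE/= in_itv/= => /andP[_ tl]; rewrite survival_Fstar_low.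
  rewrite integral_cst//= lebesgue_measure_itv/= lte_fin l0 sube0 mul1e.
  have -> : (\int[leb]_(t in `]l, V[) (Ss t)%:E =
      \int[leb]_(t in `]l, V[) (l / t)%:E)%E.
    apply: eq_integral => t; rewrite inE/= in_itv/= => /andP[lt tV].
    by rewrite survival_Fstar_mid.
  rewrite (integral_div (ltW l0) l0 lV) integral0_eq ?adde0; last first.
    by move=> t /=; rewrite in_itv/= andbT => Vt; rewrite survival_Fstar_high.
  by rewrite -EFinD -l_mean; congr EFin; ring.
- by apply/measurable_EFinP; exact: measurable_survival.
- by move=> t; rewrite lee_fin survival_ge0.
Qed.

(** The value of the game. *)
Local Notation C := (2 * l - l ^+ 2 / V).

(** For [r > l] the term [- l ^+ 2 / r] from the reserve price cancels against the integral of
    [l ^+ 2 / t ^+ 2] over []r, V[]. For [r <= l] the revenue from the reserve is [r], and the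
    stretch up to [l] adds [l - r]. *)
Lemma reserve_revenue_Fstar r : 0 <= r -> r < V ->
  reserve_revenue Fs r = C%:E.
Proof.
move=> r0 rV; rewrite (reserve_revenue_ge0E Fs r0).
(* Treats both cases at once: on [[r, m]] either the survival function is 1 or the interval is a
   point, and on []m, V[] it is [l / t]. *)
pose m := Num.max r l.
have lm : l <= m by rewrite le_max lexx orbT.
have rm : r <= m by rewrite le_max lexx.
have mV : m < V by rewrite gt_max rV.
have m0 : 0 < m by apply: lt_le_trans lm.
have mS2 : measurable_fun setT (fun t => (Ss t ^+ 2)%:E).
  by apply/measurable_EFinP; apply: measurable_funX; exact: measurable_survival.
have -> : (\int[leb]_(t in `[0%R, +oo[) ((r <= t)%R%:R * Ss t ^+ 2)%:E =
    \int[leb]_(t in `[r, +oo[) (Ss t ^+ 2)%:E)%E.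
  rewrite integral_mkcond [RHS]integral_mkcond; apply: eq_integral => t _.
  rewrite !patchE !mem_setE !in_itv/= !andbT.
  have [rt|tr] := leP r t; first by rewrite (le_trans r0 rt) mul1r.
  by case: ifP => _; rewrite ?mul0r.
rewrite (integral_bndy_split mS2 _ rm mV); last by move=> t; rewrite lee_fin sqr_ge0.
have -> : (\int[leb]_(t in `[r, m]) (Ss t ^+ 2)%:E = (m - r)%:E)%E.
  have [rl|lr] := leP r l.
    have ml : m = l by apply/max_idPr.
    rewrite (eq_integral (cst 1%E)); last first.
      move=> t; rewrite inE/= in_itv/= => /andP[_ tm].
      by rewrite survival_Fstar_low ?expr1n// -ml.
    rewrite integral_cst//= lebesgue_measure_itv/= lte_fin mul1e ml.
    move: rl; rewrite le_eqVlt => /predU1P[->|->//]; first by rewrite ltxx subrr.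
  have -> : m = r by apply/max_idPl/ltW.
  by rewrite set_itv1 integral_set1 subrr.
have -> : (\int[leb]_(t in `]m, V[) (Ss t ^+ 2)%:E =
    (l ^+ 2 / m - l ^+ 2 / V)%:E)%E.
  rewrite -(integral_div_sqr (sqr_ge0 l) m0 mV); apply: eq_integral => t.
  rewrite inE/= in_itv/= => /andP[mt tV].
  by rewrite survival_Fstar_mid ?expr_div_n//; exact: le_lt_trans mt.
rewrite integral0_eq ?adde0; last first.
  move=> t /=; rewrite in_itv/= andbT => Vt.
  by rewrite survival_Fstar_high// expr0n.
rewrite -!EFinD; congr EFin.
have [rl|lr] := leP r l.
  have -> : m = l by apply/max_idPr.
  rewrite survival_Fstar_low//; field.
  by rewrite !lt0r_neq0.
have -> : m = r by apply/max_idPl/ltW.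
rewrite survival_Fstar_mid//; field.
by rewrite !lt0r_neq0// (lt_trans l0).
Qed.

Let C_ge0 : 0 <= C.
Proof.
rewrite subr_ge0 ler_pdivrMr// expr2 -mulrA mulrCA ler_pM2l//.
have := lV; have := l0; lra.
Qed.

(** A reserve of [V] or more almost surely never sells and earns 0; a negative one earns as much as
    reserve 0. *)
Lemma reserve_revenue_Fstar_le r : (reserve_revenue Fs r <= C%:E)%E.
Proof.
rewrite (reserve_revenueE r sFs); set m := Num.max r 0.
have m0 : 0 <= m by rewrite le_max lexx orbT.
have [mV|Vm] := ltP m V; first by rewrite reserve_revenue_Fstar.
rewrite (reserve_revenue_ge0E Fs m0) survival_Fstar_high// integral0_eq.
  by rewrite mulr0 expr0n subr0 mulr0 adde0 lee_fin.
move=> t _; have [mt|] := leP m t; last by rewrite mul0r.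
by rewrite survival_Fstar_high ?expr0n ?mulr0//; exact: le_trans mt.
Qed.

Lemma revenue_Fstar_le (Q : distr R) : (revenue Fs Q <= C%:E)%E.
Proof.
apply: (@le_trans _ _ (\int[Q]_r (cst C%:E) r)%E).
  apply: ge0_le_integral => //.
  - by move=> r _; exact: reserve_revenue_ge0 sFs r.
  - exact: measurable_reserve_revenue sFs.
  - by move=> r _; exact: reserve_revenue_Fstar_le.
by rewrite integral_cst// [X in (_ * X)%E]probability_setT mule1.
Qed.

(** * Revenue of [Qstar] and the tangent inequality *)

Let q_ge0 t : 0 <= q t.
Proof.
rewrite patchE mem_setE in_itv/=; case: ifP => // /andP[lt _].
exact: Qdensity_ge0.
Qed.

Let intq : (\int[leb]_x (q x)%:E = (1 - c)%:E)%E.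
Proof.
have QT : (\int[Qs]_x (cst 1%E) x = 1)%E.
  by rewrite integral_cst// [X in (_ * X)%E]probability_setT mule1.
have := @intQs (cst 1%E) (measurable_cst _) (fun=> lee01).
rewrite QT mule1; under eq_integral do rewrite mul1e.
by move=> cq; rewrite -[LHS](@addeK _ c%:E)// [X in (X - _)%E]addeC -cq EFinB.
Qed.

(** [Qs] charges only 0 and []l, V[], where every reserve earns [C]. *)
Lemma revenue_Fstar_Qstar : revenue Fs Qs = C%:E.
Proof.
rewrite /revenue intQs; last 2 first.
- exact: measurable_reserve_revenue sFs.
- exact: reserve_revenue_ge0 sFs.
rewrite reserve_revenue_Fstar//.
have -> : (\int[leb]_x (reserve_revenue Fs x * (q x)%:E) =
    \int[leb]_x (C%:E * (q x)%:E))%E.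
  apply: eq_integral => x _; rewrite patchE mem_setE in_itv/=; case: ifP => [/andP[lx xV]|].
    by rewrite reserve_revenue_Fstar// ltW// (lt_trans l0).
  by rewrite !mule0.
rewrite ge0_integralZl//; last 2 first.
- exact/measurable_EFinP.
- by move=> x _; rewrite lee_fin.
by rewrite intq -!EFinM -EFinD; congr EFin; ring.
Qed.

(** Convexity and common slope on all of [[0, V[]. Up to [l] there is no density and [Ss t = 1], so
    both claims reduce to [Qstar V l t = c]. *)
Lemma Qstar_tangent t : 0 <= t -> t < V ->
  0 <= Qstar V l t - t * q t /\
  t * q t + (Qstar V l t - t * q t) * Ss t = c.
Proof.
move=> t0 tV; have c0 := Qatom_gt0 l0 lV.
rewrite patchE mem_setE in_itv/= tV andbT.
have [tl|lt] := leP t l.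
  rewrite survival_Fstar_low// /Qstar (le_gtF t0) tl mulr0 subr0 add0r mulr1.
  by split => //; exact: ltW.
have [h1 h2] := Qstar_high_tangent l0 lV lt.
have -> : Qstar V l t = Qmain l V t.
  rewrite /Qstar (le_gtF t0) (lt_geF lt) (ltW tV) /Qmain /Qatom; ring.
by rewrite survival_Fstar_mid.
Qed.

Let h (F : distr R) t := t * q t * (2 * survival F t - survival F t ^+ 2) +
  Qstar V l t * survival F t ^+ 2.
Let k t := (Qstar V l t - t * q t) * Ss t ^+ 2.

Let mQstar : measurable_fun setT (Qstar V l).
Proof.
apply/measurable_EFinP; rewrite (_ : _ \o _ = cdf (@idRV R : {RV Qs >-> R})).
  exact: cdf_measurable.
by apply/funext => x /=; rewrite cdfQs.
Qed.

Let mtq : measurable_fun setT (fun t : R => t * q t).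
Proof. exact: measurable_funM. Qed.

Let mh F : measurable_fun setT (h F).
Proof.
have mS := measurable_survival F.
apply: measurable_funD; apply: measurable_funM => //; last exact: measurable_funX.
by apply: measurable_funB; [exact: measurable_funM|exact: measurable_funX].
Qed.

Let mk : measurable_fun setT k.
Proof.
have mS := measurable_survival Fs.
by apply: measurable_funM; [exact: measurable_funB|exact: measurable_funX].
Qed.

Let h_ge0 F t : 0 <= t -> 0 <= h F t.
Proof.
move=> t0; apply: addr_ge0; apply: mulr_ge0 => //; last 2 first.
- by rewrite -lee_fin -cdfQs.
- exact: sqr_ge0.
- exact: mulr_ge0.
by have := survival_ge0 F t; have := survival_le1 F t; nra.
Qed.

Let k_ge0 t : 0 <= t -> 0 <= k t.
Proof.
move=> t0; have [tV|Vt] := ltP t V; last first.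
  by rewrite /k survival_Fstar_high// expr0n mulr0.
by rewrite mulr_ge0 ?sqr_ge0//; have [] := Qstar_tangent t0 tV.
Qed.

(* [h F t] is a convex quadratic in [survival F t] whose tangent at
   [survival Fs t] has slope [2 * c] and value [- k t] at 0. *)
Let h_tangent F t : supported_in F V -> 0 <= t ->
  2 * c * survival F t <= h F t + k t.
Proof.
move=> sF t0; have [tV|Vt] := ltP t V; last first.
  rewrite (survival_supported sF Vt) mulr0; apply: addr_ge0; [exact: h_ge0|exact: k_ge0].
have [D0 <-] := Qstar_tangent t0 tV; rewrite /h /k -subr_ge0.
set D := Qstar V l t - t * q t in D0 *; set x := survival F t; set y := Ss t.
(* A quadratic with leading coefficient [D] exceeds its tangent at [y] by exactly this square. *)
rewrite (_ : _ - _ = D * (x - y) ^+ 2); first by rewrite mulr_ge0 ?sqr_ge0.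
by rewrite /D; ring.
Qed.

Let h_tangent_Fs t : 0 <= t -> 2 * c * Ss t = h Fs t + k t.
Proof.
move=> t0; have [tV|Vt] := ltP t V; last first.
  by rewrite /h /k survival_Fstar_high//; ring.
by have [D0 <-] := Qstar_tangent t0 tV; rewrite /h /k; ring.
Qed.

Let revenueE F : supported_in F V ->
  revenue F Qs = (\int[leb]_(t in `[0%R, +oo[) (h F t)%:E)%E.
Proof.
move=> sF; apply: (@revenue_atom_density _ _ _ V c q _ sF cdfQs) => //.
- exact: ltW (Qatom_gt0 l0 lV).
- move=> t t0; rewrite patchE mem_setE in_itv/=.
  by case: ifP => // /andP[/(lt_trans l0) /(lt_trans t0)]; rewrite ltxx.
Qed.

(** Because the slope does not depend on [t], the integrated bound depends on [F] only through its
    mean. *)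
Let int_tangent F : supported_in F V -> ('E_F[@idRV R] = mu%:E)%E ->
  (\int[leb]_(t in `[0%R, +oo[) (2 * c * survival F t)%:E = (2 * c * mu)%:E)%E.
Proof.
move=> sF EF; rewrite EFinM -EF (expectation_survival sF) -ge0_integralZl//.
- by apply/measurable_EFinP; apply: measurable_funTS; exact: measurable_survival.
- by move=> t _; rewrite lee_fin survival_ge0.
- by rewrite lee_fin mulr_ge0// ltW// Qatom_gt0.
Qed.

Let int_hk F : (\int[leb]_(t in `[0%R, +oo[) (h F t)%:E +
    \int[leb]_(t in `[0%R, +oo[) (k t)%:E =
  \int[leb]_(t in `[0%R, +oo[) (h F t + k t)%:E)%E.
Proof.
rewrite -ge0_integralD//.
- by move=> t; rewrite /= in_itv/= andbT lee_fin; exact: h_ge0.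
- by apply/measurable_EFinP; apply: measurable_funTS; exact: mh.
- by move=> t; rewrite /= in_itv/= andbT lee_fin; exact: k_ge0.
- by apply/measurable_EFinP; apply: measurable_funTS; exact: mk.
Qed.

(* The integral of [k] is added to both revenues so that only integrals of
   nonnegative functions occur; it is finite, hence can be cancelled. *)
Lemma revenue_Qstar_ge F : value_distrs mu V F ->
  (revenue Fs Qs <= revenue F Qs)%E.
Proof.
move=> [sF EF].
set K := (\int[leb]_(t in `[0%R, +oo[) (k t)%:E)%E.
have K0 : (0 <= K)%E.
  by apply: integral_ge0 => t; rewrite /= in_itv/= andbT lee_fin; exact: k_ge0.
have eqFs : (revenue Fs Qs + K = (2 * c * mu)%:E)%E.
  rewrite (revenueE sFs) int_hk -(int_tangent sFs expectation_Fstar).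
  apply: eq_integral => t; rewrite inE/= in_itv/= andbT => t0.
  by rewrite h_tangent_Fs.
(* As the revenue [C] is nonnegative, [K] is at most the finite sum in [eqFs]. *)
have Kfin : K \is a fin_num.
  rewrite ge0_fin_numE// (@le_lt_trans _ _ (2 * c * mu)%:E) ?ltry// -eqFs.
  by rewrite revenue_Fstar_Qstar leeDr// lee_fin.
rewrite -(leeD2rE _ _ Kfin) eqFs (revenueE sF) int_hk -(int_tangent sF EF).
apply: ge0_le_integral => //.
- move=> t _; rewrite lee_fin mulr_ge0 ?survival_ge0// mulr_ge0// ltW//.
  exact: Qatom_gt0.
- apply/measurable_EFinP; apply: measurable_funM => //.
  by apply: measurable_funTS; exact: measurable_survival.
- apply/measurable_EFinP; apply: measurable_funTS; apply: measurable_funD;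
    [exact: mh|exact: mk].
- by move=> t; rewrite /= in_itv/= andbT lee_fin; exact: h_tangent.
Qed.

End fixed_equilibrium.

End equilibrium.

(** * From the saddle point to the max-min and min-max problems *)

Theorem theorem3p1 (R : realType) (mu vbar : R)
    (mu_gt0 : 0 < mu) (mu_lt : mu < vbar) :
  (exists! vlow : R, is_vlow mu vbar vlow) /\
  forall vlow : R, is_vlow mu vbar vlow ->
  exists (Qs Fs : distr R),
    [/\ has_cdf Qs (Qstar vbar vlow) /\ has_cdf Fs (Fstar vbar vlow),
        reserve_distrs vbar Qs,
        value_distrs mu vbar Fs,
        (forall Q F : distr R, reserve_distrs vbar Q -> value_distrs mu vbar F ->
          (revenue Fs Q <= revenue Fs Qs)%E /\ (revenue Fs Qs <= revenue F Qs)%E) &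
        argmax (reserve_distrs vbar) (worst_case_revenue mu vbar) Qs /\
        argmin (value_distrs mu vbar) (best_response_revenue vbar) Fs].
Proof.
split; first exact: exists_unique_vlow.
move=> l [/andP[l0 lV] l_mean].
(* A cutoff equal to [vbar] would give the mean [vbar], which exceeds [mu]. *)
have {}lV : l < vbar.
  rewrite lt_neqAle lV andbT; apply: contraTneq mu_lt => lV'.
  by rewrite -l_mean lV' addrK mulr1 ltxx.
have [Qs [mq sQs intQs cdfQs]] := exists_Qstar l0 lV.
have [Fs [sFs cdfFs]] := exists_Fstar l0 lV.
have vFs : value_distrs mu vbar Fs.
  by split => //; exact: expectation_Fstar l0 lV l_mean _ sFs cdfFs.
have le1 Q : (revenue Fs Q <= revenue Fs Qs)%E.
  rewrite (revenue_Fstar_Qstar l0 lV sFs cdfFs mq intQs).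
  exact: revenue_Fstar_le l0 lV _ sFs cdfFs Q.
have le2 F : value_distrs mu vbar F -> (revenue Fs Qs <= revenue F Qs)%E.
  exact: revenue_Qstar_ge l0 lV l_mean _ _ sFs cdfFs cdfQs mq intQs F.
exists Qs, Fs; split => //.
- by move=> Q F _ /le2.
- split; split => //.
  (* The saddle value separates the two infima: [Fs] is one of the adversary's choices against [Q],
     and no [F] brings [Qs] below the value. *)
  + move=> Q sQ; apply: (@le_trans _ _ (revenue Fs Qs)).
      by apply: ge_ereal_inf; exists (revenue Fs Q) => //; exists Fs.
    by apply: le_ereal_inf_tmp => _ [F vF <-]; exact: le2.
  (* Dually, no reserve distribution exceeds the value against [Fs], and [Qs] is one of the replies
     to [F]. *)
  + move=> F vF; apply: (@le_trans _ _ (revenue Fs Qs)).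
      by apply: ge_ereal_sup => _ [Q sQ <-]; exact: le1.
    apply: le_ereal_sup_tmp; exists (revenue F Qs); last exact: le2.
    by exists Qs.
Qed.
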